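(* Let $r,m$ be positive integers with $r\ge3$ and $r\mid m$, and put $q=2^m$, $n=2^r-1$. Let $k\ge3$, $t\ge1$, $h\ge0$ be integers with $k<n$ and $t+h\le k-1$, let $\eta\in\mathbb{F}_{2^m}^{*}$, write $\mathbb{F}_{2^r}^{*}=\{\alpha_{i_1},\ldots,\alpha_{i_n}\}\subseteq\mathbb{F}_{2^m}$, $\boldsymbol{\alpha}=(\alpha_{i_1},\ldots,\alpha_{i_n})$, and $\boldsymbol{v}=(v_1,\ldots,v_n)$ with $$v_j=\prod_{\beta\in\mathbb{F}_{2^m}\setminus\mathbb{F}_{2^r}^{*}}(\alpha_{i_j}-\beta)^{2^{m-1}}\quad(j=1,\ldots,n).$$ Then $\mathcal{C}_{\mathcal{V}_{k,t,h,\eta}}(\boldsymbol{\alpha},\boldsymbol{v})$ is self-orthogonal if one of the following conditions holds: (1) $t=2$ and $2k+t+3=2^r-1$; (2) $t$ is even with $t\ge4$, and $2k+t+1=2^r-1$; (3) $t=1$ and $2k+t+2=2^r-1$; (4) $t$ is odd with $t\ge3$, and $2k+t=2^r-1$.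
   Context: For $h\le k-1$ and $\eta\in\mathbb{F}_q^*=\mathbb{F}_q\setminus\{0\}$, $$\mathcal{V}_{k,t,h,\eta}=\Big\{\sum_{i=0}^{k-1}a_ix^i+\eta a_hx^{k-1+t}\ \Big|\ a_0,\ldots,a_{k-1}\in\mathbb{F}_q\Big\},$$ and for $\boldsymbol{\alpha}=(\alpha_{i_1},\ldots,\alpha_{i_n})$ with pairwise distinct entries in $\mathbb{F}_q$ and $\boldsymbol{v}\in(\mathbb{F}_q^* )^n$, $$\mathcal{C}_{\mathcal{V}_{k,t,h,\eta}}(\boldsymbol{\alpha},\boldsymbol{v})=\{(v_1f(\alpha_{i_1}),\ldots,v_nf(\alpha_{i_n}))\mid f\in\mathcal{V}_{k,t,h,\eta}\}.$$ A linear code $\mathcal{C}\subseteq\mathbb{F}_q^n$ is self-orthogonal if $\mathcal{C}\subseteq\mathcal{C}^\perp$ with respect to the Euclidean inner product. *)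

(* Defs.v *)
From mathcomp Require Import all_boot all_order all_algebra.

Set Implicit Arguments.
Unset Strict Implicit.
Unset Printing Implicit Defensive.

Import GRing.Theory.
Local Open Scope ring_scope.

(* The twisted polynomial with coefficients a = (a_0, ..., a_{k-1}).  It is
   meant for h < k; for h >= k the default a`_h = 0 makes the twist vanish. *)
Definition twisted_poly (F : fieldType) (k t h : nat) (eta : F)
    (a : k.-tuple F) : {poly F} :=
  \sum_(i < k) a`_i *: 'X^i + (eta * a`_h) *: 'X^(k - 1 + t).

Definition twisted_polys (F : fieldType) (k t h : nat) (eta : F)
    (f : {poly F}) : Prop :=
  exists a : k.-tuple F, f = twisted_poly t h eta a.

Definition eval_code (F : fieldType) (n : nat) (V : {poly F} -> Prop)
    (alpha v : 'rV[F]_n) (c : 'rV[F]_n) : Prop :=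
  exists2 f : {poly F}, V f & c = \row_j (v 0 j * f.[alpha 0 j]).

Definition twisted_code (F : fieldType) (n k t h : nat) (eta : F)
    (alpha v : 'rV[F]_n) : 'rV[F]_n -> Prop :=
  eval_code (twisted_polys k t h eta) alpha v.

Definition inner (F : fieldType) (n : nat) (x y : 'rV[F]_n) : F :=
  \sum_(j < n) x 0 j * y 0 j.

Definition dual_code (F : fieldType) (n : nat) (C : 'rV[F]_n -> Prop)
    (x : 'rV[F]_n) : Prop :=
  forall c : 'rV[F]_n, C c -> inner x c = 0.

Definition linear_code (F : fieldType) (n : nat) (C : 'rV[F]_n -> Prop) : Prop :=
  C 0 /\ forall (b : F) (x y : 'rV[F]_n), C x -> C y -> C (b *: x + y).

Definition self_orthogonal (F : fieldType) (n : nat)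
    (C : 'rV[F]_n -> Prop) : Prop :=
  forall x : 'rV[F]_n, C x -> dual_code C x.

Lemma twisted_polyP (F : fieldType) (k t h : nat) (eta b : F)
    (a1 a2 : k.-tuple F) :
  (h < k)%N ->
  twisted_poly t h eta [tuple b * a1`_i + a2`_i | i < k] =
  b *: twisted_poly t h eta a1 + twisted_poly t h eta a2.
Proof.
move=> hk; rewrite /twisted_poly.
have E (i : nat) : (i < k)%N ->
    [tuple b * a1`_j + a2`_j | j < k]`_i = b * a1`_i + a2`_i.
  by move=> ik; exact: (nth_mktuple (fun j : 'I_k => b * a1`_j + a2`_j) 0 (Ordinal ik)).
rewrite E //.
under eq_bigr => i _ do rewrite E // scalerDl -scalerA.
rewrite big_split /= -scaler_sumr scalerDr addrACA; congr (_ + _).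
by rewrite mulrDr scalerDl mulrCA scalerA.
Qed.

Lemma twisted_code_linear (F : fieldType) (n k t h : nat) (eta : F)
    (alpha v : 'rV[F]_n) :
  (h < k)%N -> linear_code (twisted_code k t h eta alpha v).
Proof.
move=> hk; split.
  exists 0; last by apply/rowP => j; rewrite !mxE horner0 mulr0.
  have a := nseq_tuple k (0 : F).
  exists [tuple (-1) * a`_i + a`_i | i < k].
  by rewrite twisted_polyP // scaleN1r addNr.
move=> b x y [f [a1 ->] ->] [g [a2 ->] ->].
exists (b *: twisted_poly t h eta a1 + twisted_poly t h eta a2).
  by exists [tuple b * a1`_i + a2`_i | i < k]; rewrite twisted_polyP.
by apply/rowP => j; rewrite !mxE [in RHS]hornerD hornerZ mulrDr; congr (_ + _); exact: mulrCA.
Qed.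

(* Main.v *)
Require Import Defs.
From mathcomp Require Import all_boot all_order all_algebra all_solvable all_field zify.

(** Write H for the multiplicative group of the subfield K, of order n. Squaring
    turns the exponent [2 ^ (m - 1)] in v_j into the trivial [2 ^ m = #|F|], and
    substituting b = a c in the product over the complement of H yields
    [v_j ^+ 2 = c0 * alpha_j] with c0 independent of j. Hence the inner product
    of the words of f and g is c0 times the sum of a f(a) g(a) over a in H, and
    power sums over H vanish at exponents that n does not divide. The exponents
    occurring in x f g lie between 1 and [2 * k + t - 1 < n], except for
    [2 * (k - 1 + t) + 1], which each of the four conditions keeps away from the
    multiples of n. *)

Set Implicit Arguments.
Unset Strict Implicit.
Unset Printing Implicit Defensive.

Import GRing.Theory.
Local Open Scope ring_scope.

Lemma divring_closed_nonzero (F : finFieldType) (K : {set F}) :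
  GRing.divring_closed K -> GRing.divr_closed (K :\ 0).
Proof.
case=> K1 _ Kdiv; split; first by rewrite !inE oner_eq0 K1.
move=> x y; rewrite !inE => /andP[x0 Kx] /andP[y0 Ky].
by rewrite mulf_neq0 ?invr_eq0 //= Kdiv.
Qed.

Section MulSubgroup.

Variables (F : finFieldType) (H : {set F}).
Hypotheses (H0 : 0 \notin H) (Hdiv : GRing.divr_closed H).

Lemma mulgroup_neq0 a : a \in H -> a != 0.
Proof. by move=> Ha; apply: contraNneq H0 => <-. Qed.

(** The equality of memberships, rather than mere closure, lets [x] be replaced by [a * x] in big
    operators over [H] and over [~: H] alike. *)
Lemma mem_mulgroupM a x : a \in H -> (a * x \in H) = (x \in H).
Proof.
case: Hdiv => H1 Hd Ha; have a0 := mulgroup_neq0 Ha.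
have HV y : y \in H -> y^-1 \in H by move=> Hy; rewrite -[y^-1]mul1r Hd.
apply/idP/idP => [Hax | Hx]; last by rewrite -[x]invrK Hd ?HV.
by rewrite -(mulKf a0 x) mulrC Hd.
Qed.

(** Multiplication by [a] permutes [H], so it fixes the nonzero product of all elements, which it
    also scales by [a ^+ #|H|]. *)
Lemma expr_card_mulgroup a : a \in H -> a ^+ #|H| = 1.
Proof.
move=> Ha; have a0 := mulgroup_neq0 Ha.
have P0 : \prod_(x in H) x != 0.
  by apply/prodf_neq0 => x; exact: mulgroup_neq0.
apply: (mulIf P0); rewrite mul1r [RHS](reindex_inj (mulfI a0)) /=.
under [RHS]eq_bigl => x do rewrite mem_mulgroupM //.
by rewrite big_split prodr_const.
Qed.

Lemma sum_expr_mulgroup e : ~~ (#|H| %| e)%N -> \sum_(x in H) x ^+ e = 0.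
Proof.
move=> ndvd.
have H_gt0 : (0 < #|H|)%N by apply/card_gt0P; exists 1; case: Hdiv.
(* A field containing [#|H|] distinct roots of ['X^#|H| - 1] has a primitive one among them; scaling
   by it multiplies the sum by [w ^+ e != 1]. *)
have /hasP[w] : has #|H|.-primitive_root (enum H).
  apply: has_prim_root; rewrite ?enum_uniq -?cardE //.
  by apply/allP => x; rewrite mem_enum unity_rootE => /expr_card_mulgroup->.
rewrite mem_enum => Hw prim_w; have w0 := mulgroup_neq0 Hw.
have : (w ^+ e - 1) * \sum_(x in H) x ^+ e = 0.
  rewrite mulrBl mul1r [X in _ - X](reindex_inj (mulfI w0)) /=.
  under [X in _ - X]eq_bigl => x do rewrite mem_mulgroupM //.
  under [X in _ - X]eq_bigr => x _ do rewrite exprMn.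
  by rewrite -mulr_sumr subrr.
by move/eqP; rewrite mulf_eq0 subr_eq0 -(prim_order_dvd prim_w) (negPf ndvd) => /eqP.
Qed.

(** The factor [x] shifts the exponents of [s] into the range from 1 to [#|H| - 1], away from the
    exponent 0. *)
Lemma sum_mulX_horner_mulgroup (s : {poly F}) :
  (size s < #|H|)%N -> \sum_(x in H) x * s.[x] = 0.
Proof.
move=> sz_s; under eq_bigr => x _ do rewrite horner_coef mulr_sumr.
rewrite exchange_big big1 //= => i _.
under eq_bigr => x _ do rewrite mulrCA -exprS.
rewrite -mulr_sumr sum_expr_mulgroup ?mulr0 //.
by rewrite gtnNdvd // (leq_ltn_trans (ltn_ord i)).
Qed.

Lemma prod_subr_compl_mulgroup a : a \in H ->
  \prod_(b in ~: H) (a - b) = a * \prod_(b in ~: H) (1 - b).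
Proof.
move=> Ha; rewrite (reindex_inj (mulfI (mulgroup_neq0 Ha))) /=.
under eq_bigl => x do rewrite inE mem_mulgroupM // -in_setC.
under eq_bigr => x _ do rewrite -[X in X - _]mulr1 -mulrBr.
rewrite big_split prodr_const; congr (_ * _).
(* The factors [a] make up [a ^+ #|~: H|]; multiplying by [a ^+ #|H| = 1] turns this into
   [a ^+ #|F| = a]. *)
rewrite -[LHS]mul1r -(expr_card_mulgroup Ha) -exprD cardsC.
exact: expf_card.
Qed.

End MulSubgroup.

Lemma inner_eval_mulgroup (F : finFieldType) (n : nat) (H : {set F})
    (alpha v : 'rV[F]_n) (c0 : F) (f g : {poly F}) :
  injective (fun j : 'I_n => alpha 0 j) ->
  [set alpha 0 j | j : 'I_n] = H ->
  (forall j, v 0 j ^+ 2 = c0 * alpha 0 j) ->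
  inner (\row_j (v 0 j * f.[alpha 0 j])) (\row_j (v 0 j * g.[alpha 0 j])) =
  c0 * \sum_(x in H) x * (f * g).[x].
Proof.
move=> inj_alpha <- v2; rewrite big_imset /=; last by move=> i j _ _ /inj_alpha.
rewrite /inner mulr_sumr; apply: eq_bigr => j _.
by rewrite !mxE mulrACA -expr2 v2 -mulrA hornerM.
Qed.

Lemma sum_mulX_twisted_poly (F : finFieldType) (H : {set F}) (k t h : nat)
    (eta : F) (a b : k.-tuple F) :
  0 \notin H -> GRing.divr_closed H -> (0 < k)%N -> (0 < t)%N ->
  (2 * k + t <= #|H|)%N -> ~~ (#|H| %| 2 * (k - 1 + t) + 1)%N ->
  \sum_(x in H)
    x * (twisted_poly t h eta a * twisted_poly t h eta b).[x] = 0.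
Proof.
move=> H0 Hdiv k_gt0 t_gt0 le_H ndvd; rewrite /twisted_poly.
set d := (k - 1 + t)%N in ndvd *.
have sz (c : k.-tuple F) : (size (\sum_(i < k) c`_i *: 'X^i)%R <= k)%N.
  by rewrite -(poly_def k (fun i => c`_i)) size_poly.
set u := \sum_(i < k) a`_i *: 'X^i; set w := \sum_(i < k) b`_i *: 'X^i.
set p := eta * a`_h; set q := eta * b`_h.
have sz_u : (size u <= k)%N := sz a; have sz_w : (size w <= k)%N := sz b.
(* Everything except the product of the two twists: its size is at most [k + d = 2 * k + t - 1],
   hence below [#|H|]. *)
pose s := u * w + (q *: u + p *: w) * 'X^d.
have -> : (u + p *: 'X^d) * (w + q *: 'X^d) = s + (p * q) *: 'X^(2 * d).
  rewrite /s mulrDl !mulrDr -!scalerAl -!scalerAr mulrDl -!scalerAl scalerA.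
  rewrite mul2n -addnn exprD -!addrA; congr (_ + (_ + _)).
  by rewrite (mulrC 'X^d w).
under eq_bigr => x _ do rewrite hornerD mulrDr hornerZ hornerXn mulrCA -exprS.
rewrite big_split /= -mulr_sumr -addn1 sum_expr_mulgroup // mulr0 addr0.
apply: sum_mulX_horner_mulgroup => //.
apply: leq_ltn_trans (size_polyD _ _) _; rewrite gtn_max; apply/andP; split.
  by apply: leq_ltn_trans (size_polyMleq _ _) _; lia.
apply: leq_ltn_trans (size_polyMleq _ _) _; rewrite size_polyXn.
have : (size (q *: u + p *: w)%R <= k)%N.
  apply: leq_trans (size_polyD _ _) _; rewrite geq_max.
  by rewrite !(leq_trans (size_scale_leq _ _)).
by rewrite /d; lia.
Qed.

Theorem theorem4p5 (r m n k t h : nat)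
    (hm : (0 < m)%N) (hr : (3 <= r)%N) (hrm : (r %| m)%N)
    (hn : n = (2 ^ r - 1)%N)
    (hk : (3 <= k)%N) (ht : (1 <= t)%N) (hkn : (k < n)%N)
    (hth : (t + h <= k - 1)%N)
    (F : finFieldType) (hF : #|F| = (2 ^ m)%N)
    (K : {set F}) (hK : GRing.divring_closed K) (cK : #|K| = (2 ^ r)%N)
    (eta : F) (heta : eta != 0)
    (alpha v : 'rV[F]_n)
    (alpha_inj : injective (fun j : 'I_n => alpha 0 j))
    (alphaE : [set alpha 0 j | j : 'I_n] = K :\ 0)
    (hv : forall j : 'I_n,
        v 0 j = \prod_(beta in ~: (K :\ 0)) (alpha 0 j - beta) ^+ (2 ^ (m - 1)))
    (hcond :
      [\/ (t = 2 /\ 2 * k + t + 3 = 2 ^ r - 1)%N,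
          [/\ ~~ odd t, (4 <= t)%N & (2 * k + t + 1 = 2 ^ r - 1)%N],
          (t = 1 /\ 2 * k + t + 2 = 2 ^ r - 1)%N
        | [/\ odd t, (3 <= t)%N & (2 * k + t = 2 ^ r - 1)%N]]) :
  self_orthogonal (twisted_code k t h eta alpha v).
Proof.
set H := K :\ 0 in alphaE hv.
have H0 : 0 \notin H by rewrite !inE eqxx.
have Hdiv : GRing.divr_closed H := divring_closed_nonzero hK.
have cH : #|H| = n by rewrite -alphaE card_imset // card_ord.
have v2 j : v 0 j ^+ 2 = \prod_(b in ~: H) (1 - b) * alpha 0 j.
  have Ha : alpha 0 j \in H by rewrite -alphaE imset_f.
  rewrite mulrC -(prod_subr_compl_mulgroup H0 Hdiv Ha) hv -prodrXl.
  apply: eq_bigr => b _; rewrite -exprM -expnSr subn1 prednK // -hF.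
  exact: expf_card.
have le_n : (2 * k + t <= n)%N by case: hcond => [[]|[]|[]|[]]; lia.
have ndvd : ~~ (n %| 2 * (k - 1 + t) + 1)%N.
  (* For t = 1 and t = 2 the exponent is [n - 2]; in the other odd and even cases it exceeds [n] by
     [t - 1] and [t - 2], positive by the lower bound on [t]. *)
  have [e_lt e_neq] : (2 * (k - 1 + t) + 1 < 2 * n /\ 2 * (k - 1 + t) + 1 <> n)%N.
    by case: hcond => [[]|[]|[]|[]]; lia.
  by apply/negP => /dvdnP[[|[|c]]]; nia.
move=> _ [_ [a ->] ->] _ [_ [b ->] ->].
rewrite (inner_eval_mulgroup _ _ alpha_inj alphaE v2).
by rewrite sum_mulX_twisted_poly ?mulr0 ?cH //; apply: leq_trans hk.
Qed.
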